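(* Let $b=b_1\otimes b_2\otimes\cdots\otimes b_L\in B_{\lambda_1}\otimes B_{\lambda_2}\otimes\cdots\otimes B_{\lambda_L}$ be an arbitrary path (highest weight or not), and set $N=E_1(b)=\sum_{j=1}^L E_{1,j}$. Determine pairs of numbers $(\mu_1,r_1),(\mu_2,r_2),\ldots,(\mu_N,r_N)$ by the following procedure. Step 1. Draw the table (the local energy distribution) whose entry at position $(l,j)$, i.e. in the $l$-th row and $j$-th column ($l\ge 1$, $1\le j\le L$), is $E_{l,j}-E_{l-1,j}\in\{0,1\}$. Step 2. Starting from the rightmost $1$ in the row $l=1$, pick one $1$ from each successive row, where the one picked in the $(l+1)$-th row must be weakly right of the one picked in the $l$-th row (i.e. its column index is at least that of the one picked in row $l$). If there is no such $1$ in the $(l+1)$-th row, stop; the position of the last picked $1$ is called $(\mu_1,j_1)$ ($\mu_1$ its row index, $j_1$ its column index). Change all picked $1$'s into $0$. Step 3. Repeat Step 2 (on the current table) $N-1$ more times to determine $(\mu_2,j_2),\ldots,(\mu_N,j_N)$, thereby making all $1$'s into $0$. Step 4. Determine $r_1,\ldots,r_N$ by $$r_k=\sum_{i=1}^{j_k-1}\min(\mu_k,\lambda_i)+E_{\mu_k,j_k}-2\sum_{i=1}^{j_k}E_{\mu_k,i}.$$ Then the resulting $(\lambda,(\mu,r))=\bigl((\lambda_i)_{i=1}^L,(\mu_k,r_k)_{k=1}^N\bigr)$ coincides with the (unrestricted) rigged configuration $\phi(b)$ (the ordering within the sequence of pairs $(\mu_k,r_k)$ being irrelevant).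
   Context: Crystals. For an integer $k\ge 1$, $B_k=\{(x_1,x_2)\in\mathbb{Z}_{\ge 0}^2 : x_1+x_2=k\}$; the element $(x_1,x_2)$ is identified with the one-row semistandard tableau containing $x_1$ letters $1$ and $x_2$ letters $2$. Put $u_l=(l,0)\in B_l$. A path is an element $b=b_1\otimes\cdots\otimes b_L\in B_{\lambda_1}\otimes\cdots\otimes B_{\lambda_L}$ (a sequence $(b_1,\dots,b_L)$ with $b_i\in B_{\lambda_i}$). Combinatorial $R$ and energy function. For $x=(x_1,x_2)\in B_k$ and $y=(y_1,y_2)\in B_l$, the combinatorial $R$ is the map $B_k\otimes B_l\to B_l\otimes B_k$, $x\otimes y\simeq\tilde y\otimes\tilde x$, with $\tilde x_i=x_i+Q_i-Q_{i-1}$, $\tilde y_i=y_i+Q_{i-1}-Q_i$, where $Q_i=\min(x_{i+1},y_i)$ and indices are mod $2$ (so $Q_0=Q_2=\min(x_1,y_2)$, $Q_1=\min(x_2,y_1)$). The energy function is $H(x\otimes y)=Q_0=\min(x_1,y_2)$. Local energies. For a path $b$ and $l\ge 1$, put $u_l^{(0)}=u_l$ and define $u_l^{(j)}\in B_l$ and $b_j'\in B_{\lambda_j}$ recursively by $u_l^{(j-1)}\otimes b_j\simeq b_j'\otimes u_l^{(j)}$. Set $E_{l,j}=H(u_l^{(j-1)}\otimes b_j)$, $E_{0,j}=0$, and $E_l=E_l(b)=\sum_{j=1}^L E_{l,j}$. The map $\phi$ (Kerov--Kirillov--Reshetikhin map). $\phi(b)=(\lambda,(\mu,r))$ consists of a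 sequence of rows $\lambda$ (the quantum space) and a finite multiset of pairs $(\mu_j,r_j)$ (a row of length $\mu_j\ge1$ of the configuration $\mu$ with its rigging $r_j\in\mathbb{Z}$). Given $\lambda,\mu$, set $Q_j^{(0)}=\sum_k\min(j,\lambda_k)$, $Q_j^{(1)}=\sum_k\min(j,\mu_k)$; the vacancy number is $p_j=Q_j^{(0)}-2Q_j^{(1)}$, and a row $\mu_i$ is singular if $r_i=p_{\mu_i}$. One starts with $\lambda=\mu=\emptyset$ and processes $b_1,b_2,\dots,b_L$ in this order; within $b_i$ one processes first all letters $2$ and then all letters $1$, one letter at a time. Each letter of $b_i$ adds one box to the $i$-th row of $\lambda$ (which has length $0$ before its first letter). A letter $1$ does nothing else: $\mu$ and all riggings are unchanged. For a letter $2$, in addition, one box is added to the longest row of $\mu$ that is singular with respect to the vacancy numbers before this letter is processed (if there is no singular row, a new row of length $1$ is created in $\mu$); the rigging of the row that was lengthened or created is then set equal to its vacancy number computed from the new $\lambda$ and $\mu$, and all other riggings are unchanged. The result $\phi(b)$ is called the rigged configuration if $b$ is highest weight, and the unrestricted rigged configuration for general $b$. *)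

(* Defs.v *)
From mathcomp Require Import all_boot all_order all_algebra.

Set Implicit Arguments.
Unset Strict Implicit.
Unset Printing Implicit Defensive.

Import Order.TTheory GRing.Theory Num.Theory.

(* Rows (l), columns (j) and tensor factors are numbered from 1, as on paper;
   [seq]s are accessed through [item], which shifts the index. *)
Definition item (T : Type) (x0 : T) (s : seq T) (i : nat) : T := nth x0 s i.-1.

(** * Crystals, combinatorial R, energy function *)

Definition B (k : nat) : pred (nat * nat) := [pred x | x.1 + x.2 == k].

Definition Q0 (x y : nat * nat) : nat := minn x.1 y.2.
Definition Q1 (x y : nat * nat) : nat := minn x.2 y.1.

(* [combR x y] is the pair (y~, x~) such that x (x) y ~ y~ (x) x~.
   The truncated subtractions are exact: Q0 <= x.1, y.2 and Q1 <= x.2, y.1. *)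
Definition combR (x y : nat * nat) : (nat * nat) * (nat * nat) :=
  ((y.1 + Q0 x y - Q1 x y, y.2 + Q1 x y - Q0 x y),
   (x.1 + Q1 x y - Q0 x y, x.2 + Q0 x y - Q1 x y)).

Definition H (x y : nat * nat) : nat := Q0 x y.

(** * Paths and local energies *)

Definition is_path (lam : seq nat) (b : seq (nat * nat)) : Prop :=
  size b = size lam /\
  forall i, 1 <= i <= size lam -> item (0, 0) b i \in B (item 0 lam i).

Fixpoint carrier (b : seq (nat * nat)) (l j : nat) : nat * nat :=
  if j is j'.+1 then (combR (carrier b l j') (item (0, 0) b j)).2 else (l, 0).

Definition locE (b : seq (nat * nat)) (l j : nat) : nat :=
  if l == 0 then 0 else H (carrier b l j.-1) (item (0, 0) b j).

Definition energy (b : seq (nat * nat)) (l : nat) : nat :=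
  \sum_(1 <= j < (size b).+1) locE b l j.

(** * The map phi *)

(* (quantum space, rows of the configuration with their riggings).  The second
   component stands for a multiset: only its class up to [perm_eq] matters. *)
Definition rigged : Type := (seq nat * seq (nat * int))%type.

Local Open Scope ring_scope.

Definition vacancy (lam mu : seq nat) (j : nat) : int :=
  (\sum_(k <- lam) minn j k)%N%:Z - 2 * (\sum_(k <- mu) minn j k)%N%:Z.

Definition lengths (rows : seq (nat * int)) : seq nat := [seq row.1 | row <- rows].

Definition singular (rc : rigged) (row : nat * int) : bool :=
  row.2 == vacancy rc.1 (lengths rc.2) row.1.

(* 0 if there is no singular row *)
Definition longest_singular (rc : rigged) : nat :=
  (\max_(row <- rc.2 | singular rc row) row.1)%N.

(* With m the length of a longest singular row, that row is the pair
   (m, p_m); one copy of it is replaced by a row of length m + 1.  Rows of the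
   configuration have positive length, so when no row is singular (m = 0)
   nothing is removed and a row of length 1 is created. *)
Definition add_two (i : nat) (rc : rigged) : rigged :=
  let m := longest_singular rc in
  let rest := rem (m, vacancy rc.1 (lengths rc.2) m) rc.2 in
  let lam' := incr_nth rc.1 i.-1 in
  let mu' := m.+1 :: lengths rest in
  (lam', (m.+1, vacancy lam' mu' m.+1) :: rest).

Definition add_one (i : nat) (rc : rigged) : rigged :=
  (incr_nth rc.1 i.-1, rc.2).

Definition add_factor (b : seq (nat * nat)) (rc : rigged) (i : nat) : rigged :=
  let x := item (0%N, 0%N) b i in
  iter x.1 (add_one i) (iter x.2 (add_two i) rc).

Definition phi (b : seq (nat * nat)) : rigged :=
  foldl (add_factor b) ([::], [::]) (iota 1 (size b)).

(** * The picking procedure *)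

Definition table : Type := nat -> nat -> int.

Definition local_energy_distribution (b : seq (nat * nat)) : table :=
  fun l j => if (1 <= l)%N && (1 <= j <= size b)%N
             then (locE b l j)%:Z - (locE b l.-1 j)%:Z else 0.

(* [c] lists the columns of the 1's picked in rows 1, ..., [size c] during one
   execution of Step 2.  When several 1's are admissible in a row any of them
   may be picked, hence a relation. *)
Definition picking (T : table) (c : seq nat) : Prop :=
  [/\ (1 <= size c)%N,
      forall l, (1 <= l <= size c)%N -> T l (item 0%N c l) = 1,
      forall j, (item 0%N c 1 < j)%N -> T 1%N j <> 1,
      forall l, (1 <= l < size c)%N -> (item 0%N c l <= item 0%N c l.+1)%N
    & forall j, (item 0%N c (size c) <= j)%N -> T (size c).+1 j <> 1].

Definition erase (T : table) (c : seq nat) : table :=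
  fun l j => if (1 <= l <= size c)%N && (j == item 0%N c l) then 0 else T l j.

(* [rounds T s T']: executing Step 2 [size s] times on [T] can yield the
   successive last positions [s] and leave the table [T']. *)
Inductive rounds : table -> seq (nat * nat) -> table -> Prop :=
| rounds_nil T : rounds T [::] T
| rounds_cons T c s T' :
    picking T c -> rounds (erase T c) s T' ->
    rounds T ((size c, item 0%N c (size c)) :: s) T'.

Definition rigging (lam : seq nat) (b : seq (nat * nat)) (mu j : nat) : int :=
  (\sum_(1 <= i < j) minn mu (item 0%N lam i))%N%:Z + (locE b mu j)%:Z
  - 2 * (\sum_(1 <= i < j.+1) locE b mu i)%N%:Z.

(* Main.v *)
Require Import Defs.
From mathcomp Require Import all_boot all_order all_algebra.
From mathcomp Require Import zify.

(* Picture a carrier of infinite capacity as a row of slots, all empty at first: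
   on reading b_j = (x1, x2), the lowest x2 empty slots are filled while the
   lowest x1 full slots are emptied.  The carrier u_l^(j) is the content of the
   first l slots, so the table has a 1 at (l, j) exactly when slot l is filled
   by b_j.  A slot is never emptied without the full slots below it being
   emptied too, hence between two consecutive 1's of row l + 1 there is a 1 of
   row l.  This interlacing makes Step 2 deterministic: it always picks the
   rightmost 1's, and the strings end exactly at those 1's (l, p) such that
   row l + 1 has no 1 between column p and the next 1 of row l.
   Now add letters one by one.  A letter 2 creates a 1 in the lowest empty slot
   l, so the rightmost string of length l - 1 is lengthened.  For a string
   (mu, j) of Step 4, vacancy minus rigging is mu - (number of full slots among
   the first mu) plus a nonnegative slack, so a singular string is no longer
   than l - 1; and the rightmost string of length l - 1 has no slack. *)

Set Implicit Arguments.
Unset Strict Implicit.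
Unset Printing Implicit Defensive.

(** * The picking procedure on interlaced tables *)


(** The last clause places [p] strictly right of the preceding 1 of row [l.+1], so a 1 of row [l]
    separates two consecutive 1's of row [l.+1]. *)
Definition interlaced (T : table) : Prop :=
  forall l q, 1 <= l -> T l.+1 q = 1%R ->
    exists p, [/\ p <= q, T l p = 1%R
                & forall q', q' < q -> T l.+1 q' = 1%R -> q' < p].

Definition zero_one (m n : nat) (T : table) : Prop :=
  (forall l j, T l j = 0%R \/ T l j = 1%R) /\
  (forall l j, T l j = 1%R -> 1 <= l <= m /\ 1 <= j <= n).

(** Refers to the table alone and to no picking, so that the outcome of the rounds can be described
    independently of the choices made. *)
Definition string_end (T : table) (lp : nat * nat) : Prop :=
  T lp.1 lp.2 = 1%R /\
  forall q, lp.2 <= q -> T lp.1.+1 q = 1%R ->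
    exists p, lp.2 < p <= q /\ T lp.1 p = 1%R.

Section Picking.

Variables (m n : nat) (T : table) (c : seq nat).
Hypotheses (T01 : zero_one m n T) (Til : interlaced T) (Tc : picking T c).

(** By interlacing, a 1 of row [l.+1] right of its pick would force a 1 of row [l] right of that
    same pick, hence right of the pick of row [l]. *)
Lemma picking_rightmost l j :
  1 <= l <= size c -> item 0 c l < j -> T l j <> 1%R.
Proof.
have [_ c1 cr cle _] := Tc.
elim: l j => [|[|l] IHl] j // lc; first exact: cr.
move=> ltj Tj; have [p [_ Tp hp]] := Til (isT : 1 <= l.+1) Tj.
have ltp : item 0 c l.+2 < p by apply: hp => //; apply: c1.
have lel : item 0 c l.+1 <= item 0 c l.+2 by apply: cle.
by apply: (IHl p) Tp; lia.
Qed.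

Lemma eraseE l j :
  erase T c l j = 1%R <->
  T l j = 1%R /\ ~ (1 <= l <= size c /\ j = item 0 c l).
Proof.
rewrite /erase; case: ifP => [/andP[lc /eqP jc] | nlc].
  by split=> [// | [_ []]].
split=> [-> | [-> _] //]; split=> // -[lc jc].
by rewrite lc jc eqxx in nlc.
Qed.

(** For [l = size c] the stopping rule excludes any other [q]. Otherwise [q] would lie between the
    picks of rows [l] and [l.+1], and interlacing would give a 1 of row [l] right of its rightmost
    one. So no erased 1 is needed to interlace the remaining ones. *)
Lemma erase_left l q :
  1 <= l <= size c -> erase T c l.+1 q = 1%R -> q < item 0 c l.
Proof.
have [_ c1 _ cle clast] := Tc.
move=> lc /eraseE[Tq nq]; rewrite ltnNge; apply/negP => leq.
have [eql | nel] := eqVneq l (size c).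
  by case: (clast q); rewrite -eql.
have lc' : 1 <= l.+1 <= size c by lia.
have ltq : q < item 0 c l.+1.
  rewrite ltn_neqAle; apply/andP; split.
    by apply/eqP => eq_q; apply: nq.
  by rewrite leqNgt; apply/negP => /(picking_rightmost lc') [].
have l1 : 1 <= l by lia.
have [p' [_ Tp' hp']] := Til l1 (c1 _ lc').
apply: (picking_rightmost lc _ Tp').
by apply: leq_ltn_trans leq (hp' _ ltq Tq).
Qed.

Lemma erase_zero_one : zero_one m n (erase T c).
Proof.
split=> l j; last by move=> /eraseE[/T01.2].
by rewrite /erase; case: ifP => _; [left | apply: T01.1].
Qed.

Lemma erase_interlaced : interlaced (erase T c).
Proof.
move=> l q l1 Tq; have /eraseE[Tq1 _] := Tq.
have [p [lepq Tp hp]] := Til l1 Tq1.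
exists p; split=> // [|q' ltq /eraseE[Tq' _]]; last exact: hp.
apply/eraseE; split=> // -[lc pc].
by have := erase_left lc Tq; rewrite -pc ltnNge lepq.
Qed.

(** One execution of Step 2 uses up the end where it stops and no other: the erased 1's of rows [l]
    and [l.+1] are rightmost, the former weakly left of the latter, so they do not affect the test
    at a remaining 1 of row [l]. *)
Lemma string_end_erase lp :
  string_end T lp <->
  lp = (size c, item 0 c (size c)) \/ string_end (erase T c) lp.
Proof.
have [c0 c1 _ cle clast] := Tc.
split; last first.
  case=> [-> | [/= T'p hp]]; rewrite /string_end /=.
    split=> [|q leq Tq]; last by case: (clast q).
    by apply: c1; rewrite c0 leqnn.
  have /eraseE[Tp np] := T'p.
  split=> // q leq Tq.
  have [eql | nel] := boolP ((lp.1.+1 <= size c) && (q == item 0 c lp.1.+1)).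
    have {eql} [lc /eqP eq_q] := andP eql.
    have l1 : 1 <= lp.1 by have [/andP[]] := T01.2 _ _ Tp.
    have lc1 : 1 <= lp.1 <= size c by lia.
    exists (item 0 c lp.1); split; last exact: c1.
    rewrite eq_q cle ?andbT; last by lia.
    rewrite ltn_neqAle; apply/andP; split; first by apply/eqP => eqp; apply: np.
    by rewrite leqNgt; apply/negP => /(picking_rightmost lc1) [].
  have [|p [ltp /eraseE[Tp' _]]] := hp q leq; last by exists p.
  by apply/eraseE; split=> // -[/andP[_ lc] eq_q]; rewrite lc eq_q eqxx in nel.
case: lp => l p [/= Tp hp].
have l1 : 1 <= l by have [/andP[]] := T01.2 _ _ Tp.
have [/andP[lc /eqP pc] | npc] := boolP ((l <= size c) && (p == item 0 c l)).
  left; have [<- | nel] := eqVneq l (size c); first by rewrite -pc.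
  have lc1 : 1 <= l.+1 <= size c by lia.
  have [||p' [/andP[ltp _] Tp']] := hp (item 0 c l.+1).
  - by rewrite pc cle; lia.
  - exact: c1.
  have lc2 : 1 <= l <= size c by lia.
  by case: (picking_rightmost lc2 _ Tp'); rewrite -pc.
right; split=> /= [|q leq T'q].
  by apply/eraseE; split=> // -[/andP[_ lc] pc]; rewrite lc pc eqxx in npc.
have /eraseE[Tq _] := T'q.
have [p' [/andP[ltp leq'] Tp']] := hp q leq Tq.
exists p'; split; first by rewrite ltp.
apply/eraseE; split=> // -[lc pc].
by have := erase_left lc T'q; rewrite -pc ltnNge leq'.
Qed.

Lemma string_end_erased : ~ string_end (erase T c) (size c, item 0 c (size c)).
Proof.
have [c0 _ _ _ _] := Tc.
by case=> /= /eraseE[_ []]; rewrite c0 leqnn.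
Qed.

Lemma row1_erase :
  \sum_(1 <= j < n.+1) (T 1 j == 1%R) =
  (\sum_(1 <= j < n.+1) (erase T c 1 j == 1%R)).+1.
Proof.
have [c0 c1 _ _ _] := Tc.
have T1 : T 1 (item 0 c 1) = 1%R by apply: c1.
have [_ jn] := T01.2 _ _ T1.
have jin : item 0 c 1 \in index_iota 1 n.+1 by rewrite mem_index_iota; lia.
rewrite !(bigD1_seq _ jin (iota_uniq _ _)) /= T1 /erase c0 !eqxx /=.
rewrite add0n; congr _.+1; apply: eq_bigr => j nj.
by rewrite (negbTE nj).
Qed.

End Picking.

Lemma picking_exists m n T j :
  zero_one m n T -> T 1 j = 1%R -> exists c, picking T c.
Proof.
move=> T01 Tj.
have [j0 /eqP Tj0 max_j0] : {j0 | T 1 j0 == 1%R & forall i, T 1 i == 1%R -> i <= j0}.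
  have exj : exists j0, T 1 j0 == 1%R by exists j; apply/eqP.
  have leb i : T 1 i == 1%R -> i <= n by move=> /eqP /T01.2 [_ /andP[]].
  by case: (ex_maxnP exj leb) => i Ti max_i; exists i.
have rightmost i : j0 < i -> T 1 i <> 1%R.
  by rewrite ltnNge => /negP nle /eqP /max_j0.
pose chain c := [/\ 1 <= size c, item 0 c 1 = j0,
  forall l, 1 <= l <= size c -> T l (item 0 c l) = 1%R
  & forall l, 1 <= l < size c -> item 0 c l <= item 0 c l.+1].
(* [d] bounds the number of rows left to visit; at [d = 0] the chain has reached row [m], beyond
   which the table is zero, so the stopping rule holds. *)
have grow : forall d c, m <= size c + d -> chain c -> exists c', picking T c'.
  elim=> [|d IHd] c lem [c0 cj c1 cle].
    exists c; split=> // [|i _ /T01.2[]]; last by lia.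
    by rewrite cj.
  have [[i [lei Ti]] | none] :
      (exists i, item 0 c (size c) <= i /\ T (size c).+1 i = 1%R) \/
      (forall i, item 0 c (size c) <= i -> T (size c).+1 i <> 1%R).
    have [/hasP[i _ /andP[lei /eqP Ti]] | /hasPn none] :=
      boolP (has (fun i => (item 0 c (size c) <= i) && (T (size c).+1 i == 1%R))
                 (index_iota 1 n.+1)); first by left; exists i.
    right=> i lei Ti; have [_ ni] := T01.2 _ _ Ti.
    have : i \in index_iota 1 n.+1 by rewrite mem_index_iota; lia.
    by move=> /none; rewrite lei Ti eqxx.
  - have old l : 1 <= l <= size c -> item 0 (rcons c i) l = item 0 c l.
      by move=> lc; rewrite /item nth_rcons; have -> : l.-1 < size c by lia.
    have new : item 0 (rcons c i) (size c).+1 = i.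
      by rewrite /item nth_rcons ltnn eqxx.
    apply: (IHd (rcons c i)); rewrite /chain size_rcons; first by lia.
    split=> // [|l lc|l lc]; first by rewrite old ?c0.
      have [-> | nel] := eqVneq l (size c).+1; first by rewrite new.
      by rewrite old ?c1; lia.
    rewrite old; last by lia.
    have [-> | nel] := eqVneq l (size c); first by rewrite new.
    by rewrite old ?cle; lia.
  - exists c; split=> //; by rewrite cj.
by apply: (grow m [:: j0]); rewrite ?leq_addl //; split=> // -[|[|l]].
Qed.

(** Once [T'] is empty, this makes [s] the list of all string ends of [T], each occurring once,
    whatever was picked. *)
Lemma roundsP m n T s T' :
  rounds T s T' -> zero_one m n T -> interlaced T ->
  [/\ zero_one m n T', interlaced T',
      \sum_(1 <= j < n.+1) (T 1 j == 1%R) =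
        size s + \sum_(1 <= j < n.+1) (T' 1 j == 1%R),
      uniq s
    & [/\ forall lp, string_end T lp <-> lp \in s \/ string_end T' lp
        & forall lp, lp \in s -> ~ string_end T' lp]].
Proof.
elim=> {T s T'} [T | T c s T' Tc _ IH] T01 Til.
  by split=> //; split=> // lp; split=> [|[]//]; right.
have [T'01 T'il eq_row us [ends disj]] :=
  IH (erase_zero_one c T01) (erase_interlaced Til Tc).
split=> //.
- by rewrite (row1_erase T01 Tc) eq_row addSn.
- rewrite /= us andbT; apply/negP => cs.
  by apply: (string_end_erased Tc); apply/ends; left.
- split=> lp.
    rewrite (string_end_erase T01 Til Tc) ends in_cons.
    split; first by case=> [-> | [-> | ?]]; rewrite ?eqxx ?orbT; auto.
    by case=> [/orP[/eqP-> | ?] | ?]; auto.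
  rewrite in_cons => /orP[/eqP-> T'e | /disj //].
  by apply: (string_end_erased Tc); apply/ends; right.
Qed.

Lemma interlaced_row1 T l j :
  interlaced T -> (forall p, T 1 p <> 1%R) -> 1 <= l -> T l j <> 1%R.
Proof.
move=> Til T1; elim: l j => [|[|l] IHl] j // _ Tj.
have [p [_ Tp _]] := Til l.+1 j isT Tj.
exact: (IHl p isT Tp).
Qed.

(** * Slots of the infinite carrier *)


(** The number of full slots among the first [l]. *)
Definition twos (b : seq (nat * nat)) (l j : nat) : nat := (carrier b l j).2.

(* Slots are counted from 0, and columns by the number of columns already read:
   slot l and step j stand for row l.+1 and column j.+1 of the table. *)
Definition full (b : seq (nat * nat)) (l j : nat) : bool :=
  twos b l j < twos b l.+1 j.

Definition fills (b : seq (nat * nat)) (l j : nat) : bool :=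
  locE b l j.+1 < locE b l.+1 j.+1.

Section Slots.

Variable b : seq (nat * nat).

Lemma carrier_total l j : (carrier b l j).1 + twos b l j = l.
Proof.
rewrite /twos; elim: j => [|j IHj] /=; first by rewrite addn0.
by move: IHj; rewrite /Q0 /Q1; lia.
Qed.

Lemma twos_le l j : twos b l j <= l.
Proof. by have := carrier_total l j; lia. Qed.

Lemma twosS l j :
  twos b l j.+1 = twos b l j + minn (l - twos b l j) (nth (0, 0) b j).2
                  - minn (twos b l j) (nth (0, 0) b j).1.
Proof.
by have := carrier_total l j; rewrite /twos /= /Q0 /Q1 /item /=; lia.
Qed.

Lemma locES l j :
  locE b l j.+1 = minn (l - twos b l j) (nth (0, 0) b j).2.
Proof.
have := carrier_total l j; rewrite /locE /H /Q0 /item /=.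
by case: eqP => [->|_]; lia.
Qed.

(** Consistency of the slot picture: carriers of consecutive capacities differ only in the content
    of slot [l]. *)
Lemma twos_step l j : twos b l j <= twos b l.+1 j <= (twos b l j).+1.
Proof.
elim: j => [|j IHj] //; have := twos_le l j; have := twos_le l.+1 j.
by rewrite !twosS; lia.
Qed.

Lemma holes_homo j : {homo (fun l => l - twos b l j) : l m / l <= m}.
Proof.
apply: homo_leq => // [|l]; first by move=> y x z; apply: leq_trans.
by have := twos_step l j; have := twos_le l j; lia.
Qed.

(** Slot [l] has [l - twos b l j] empty slots below it, and these are served first. *)
Lemma fillsE l j :
  fills b l j = ~~ full b l j && (l - twos b l j < (nth (0, 0) b j).2).
Proof.
rewrite /fills /full !locES; have := twos_step l j.
by have := twos_le l j; have := twos_le l.+1 j; lia.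
Qed.

(** A full slot survives when the [twos b l j] full slots below it absorb all letters 1. *)
Lemma fullS l j :
  full b l j.+1 =
  fills b l j || full b l j && ((nth (0, 0) b j).1 <= twos b l j).
Proof.
rewrite fillsE /full !twosS; have := twos_step l j.
by have := twos_le l j; have := twos_le l.+1 j; lia.
Qed.

Lemma full0 l : full b l 0 = false.
Proof. by rewrite /full /twos. Qed.

(** All slots start empty. A filling at step [p] is visible in [full] from [p.+1] on, whence the
    range of [t]. *)
Lemma full_last_fill l j :
  full b l j ->
  exists2 p, p < j & fills b l p /\ forall t, p < t <= j -> full b l t.
Proof.
elim: j => [|j IHj]; first by rewrite full0.
move=> fj; have := fj; rewrite fullS => /orP[fill_j | /andP[/IHj[p ltp [fp hp]] _]].
  by exists j => //; split=> // t ht; have -> : t = j.+1 by lia.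
exists p; first by lia.
split=> // t ht; have [-> // | nt] := eqVneq t j.+1.
by apply: hp; lia.
Qed.

(* Emptying slot l.+1 takes more letters 1 than there are full slots below it,
   so it empties slot l as well. *)
Lemma full_stays l p j q :
  (forall t, p < t <= j -> full b l t) ->
  p < q <= j -> full b l.+1 q -> full b l.+1 j.
Proof.
elim: j => [|j IHj] fl hq fq; first by lia.
have [<- // | nq] := eqVneq q j.+1.
have {IHj} fj : full b l.+1 j by apply: IHj => // [t ht|]; [apply: fl | ]; lia.
have fl1 : full b l j by apply: fl; lia.
have : full b l j.+1 by apply: fl; lia.
rewrite !fullS fillsE fl1 fj /= => le1; apply/orP; right.
by have := twos_step l j; lia.
Qed.

Lemma full_fills l p j q :
  (forall t, p < t <= j -> full b l t) -> ~~ full b l.+1 j ->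
  p <= q < j -> ~~ fills b l.+1 q.
Proof.
move=> fl nf hq; apply: contra nf => fq.
by apply: (@full_stays l p j q.+1); rewrite ?fullS ?fq //; lia.
Qed.

(** If slot [l] is empty at [q], it is filled together with slot [l.+1], and [p = q]. If it is full,
    [p] is its last filling: slot [l.+1], being empty at [q], has not been filled since, by
    [full_fills]. *)
Lemma fills_interlaced l q :
  fills b l.+1 q ->
  exists p, [/\ p <= q, fills b l p
              & forall q', q' < q -> fills b l.+1 q' -> q' < p].
Proof.
move=> fq; have := fq; rewrite fillsE => /andP[nf le2].
have [fl | nfl] := boolP (full b l q); last first.
  exists q; split=> //; rewrite fillsE nfl /=.
  by have := holes_homo q (leqnSn l); lia.
have [p ltp [fp hp]] := full_last_fill fl.
exists p; split=> // [|q' ltq fq']; first by lia.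
rewrite ltnNge; apply/negP => lepq.
have := full_fills hp nf (q := q'); rewrite fq' lepq ltq.
by move=> /(_ isT).
Qed.

Lemma twos_bound l j : j <= size b -> twos b l j <= \sum_(x <- take j b) x.2.
Proof.
elim: j => [|j IHj] lej; first by rewrite /twos.
rewrite (take_nth (0, 0) lej) -cats1 big_cat big_seq1 /= twosS.
by have := IHj (ltnW lej); lia.
Qed.

Lemma fills_bound l j : fills b l j -> l < \sum_(x <- b) x.2 /\ j < size b.
Proof.
rewrite fillsE => /andP[_ le2].
have ltj : j < size b.
  rewrite ltnNge; apply/negP => /(nth_default (0, 0)) ej.
  by rewrite ej in le2.
split=> //; have := twos_bound l (ltnW ltj).
have -> : \sum_(x <- b) x.2 = \sum_(x <- take j.+1 b ++ drop j.+1 b) x.2.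
  by rewrite cat_take_drop.
by rewrite (take_nth (0, 0) ltj) -cats1 !big_cat big_seq1 /=; lia.
Qed.

Lemma tableS l j :
  local_energy_distribution b l.+1 j.+1 = (fills b l j)%:R%R.
Proof.
rewrite /local_energy_distribution /=.
have [ltj | lej] := ltnP j (size b); last first.
  by have -> : fills b l j = false by apply/negP => /fills_bound[]; lia.
have : locE b l j.+1 <= locE b l.+1 j.+1 <= (locE b l j.+1).+1.
  rewrite !locES; have := twos_step l j.
  by have := twos_le l j; have := twos_le l.+1 j; lia.
by rewrite /fills; case: ltnP => /=; lia.
Qed.

End Slots.

(** * Ends of strings and their riggings *)


Lemma table_one b l j :
  local_energy_distribution b l.+1 j.+1 = 1%R <-> fills b l j.
Proof. by rewrite tableS; case: (fills b l j). Qed.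

Lemma table_oneP b l j :
  local_energy_distribution b l j = 1%R -> 0 < l /\ 0 < j.
Proof. by case: l j => [|l] [|j]. Qed.

Lemma table_zero_one b :
  zero_one (\sum_(x <- b) x.2) (size b) (local_energy_distribution b).
Proof.
split=> l j.
  case: l j => [|l] [|j]; try by left.
  by rewrite tableS; case: (fills b l j); [right | left].
move=> Tj; have [l0 j0] := table_oneP Tj.
by case: l j l0 j0 Tj => [|l] [|j] // _ _ /table_one/fills_bound[].
Qed.

Lemma table_interlaced b : interlaced (local_energy_distribution b).
Proof.
move=> [|l] // [|q] _; first by case/table_oneP.
move=> /table_one/fills_interlaced[p [lepq fp hp]].
exists p.+1; split=> // [|[|q'] ltq]; [exact/table_one | by [] |].
by move=> /table_one/hp; apply.
Qed.

Definition slot_end (b : seq (nat * nat)) (lp : nat * nat) : Prop :=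
  fills b lp.1 lp.2 /\
  forall q, lp.2 <= q -> fills b lp.1.+1 q ->
    exists p, lp.2 < p <= q /\ fills b lp.1 p.

Lemma string_endE b l p :
  string_end (local_energy_distribution b) (l.+1, p.+1) <-> slot_end b (l, p).
Proof.
split=> -[/= fp hp]; split=> /=.
- exact/table_one.
- move=> q leq /table_one fq; have [//|[|p'] [] // ltp /table_one fp'] := hp q.+1 _ fq.
  by exists p'.
- exact/table_one.
- case=> // q leq /table_one fq; have [//|p' [ltp fp']] := hp q _ fq.
  by exists p'.+1; split=> //; apply/table_one.
Qed.

Definition weights (b : seq (nat * nat)) : seq nat := [seq x.1 + x.2 | x <- b].

Definition end_row (b : seq (nat * nat)) (lp : nat * nat) : nat * int :=
  (lp.1.+1, rigging (weights b) b lp.1.+1 lp.2.+1).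

(** * Comparison of riggings with vacancy numbers along the columns *)

Section Levels.
Local Open Scope ring_scope.

(* Equals the vacancy number, the strings accounting for E_m boxes in the first
   m columns of the configuration. *)
Definition level (b : seq (nat * nat)) (m n : nat) : int :=
  (\sum_(0 <= t < n) minn m (nth 0%N (weights b) t))%N%:Z
  - 2 * (\sum_(0 <= t < n) locE b m t.+1)%N%:Z.

Lemma levelS b m n :
  level b m n.+1 =
  level b m n + (minn m (nth 0%N (weights b) n))%:Z - 2 * (locE b m n.+1)%:Z.
Proof. by rewrite /level !big_nat_recr //=; lia. Qed.

(** The energy of the last column occurs in Step 4 with coefficient [1 - 2]. *)
Lemma riggingS b m p :
  rigging (weights b) b m p.+1 = level b m p - (locE b m p.+1)%:Z.
Proof.
rewrite /rigging /level !big_add1 /= big_nat_recr //=.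
by set u := (X in X%:Z + _); set v := (X in _ = X%:Z - _ - _);
   have -> : u = v by []; lia.
Qed.

Lemma nth_weights b t :
  nth 0%N (weights b) t = ((nth (0, 0) b t).1 + (nth (0, 0) b t).2)%N.
Proof.
have [ltt | let_] := ltnP t (size b); first by rewrite (nth_map (0%N, 0%N)).
by rewrite !nth_default ?size_map.
Qed.

(** Put [m = l.+1]. Column [p] fills every empty slot among the first [m], so the left side is
    [level + twos] just before it. This sum never decreases: a factor [(x1, x2)] adds
    [minn m (x1 + x2)] minus the number of the first [m] slots that it fills or empties, which is at
    most [m] and at most [x1 + x2]. *)
Lemma rigging_le_level b l p n :
  fills b l p -> (p < n)%N ->
  rigging (weights b) b l.+1 p.+1 + l.+1%:Z <=
  level b l.+1 n + (twos b l.+1 n)%:Z.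
Proof.
rewrite fillsE /full => /andP[nf le2].
have [[s1 s2] s3] := (twos_step b l p, twos_le b l p, twos_le b l.+1 p).
elim: n => // n IHn; rewrite ltnS leq_eqVlt => /orP[/eqP <- | /IHn {}IHn].
  by rewrite riggingS levelS nth_weights twosS !locES; lia.
have := twos_le b l.+1 n.
by rewrite levelS nth_weights twosS !locES; lia.
Qed.

(** After column [p] the sum stays constant: slot [l] staying full, all letters 1 act below it; slot
    [l.+1] staying empty, all letters 2 do. So each letter changes one of the first [l.+1] slots. *)
Lemma rigging_eq_level b l p n :
  fills b l p -> (p < n)%N ->
  (forall t, (p < t <= n)%N -> full b l t && ~~ full b l.+1 t) ->
  rigging (weights b) b l.+1 p.+1 + l.+1%:Z =
  level b l.+1 n + (twos b l.+1 n)%:Z.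
Proof.
rewrite fillsE {1}/full => /andP[nf le2].
elim: n => // n IHn; rewrite ltnS leq_eqVlt => /orP[/eqP <- | ltp] fl.
  (* In column [p], either the letters 2 are used up by the first [l.+1] slots, or slot [l.+1] is
     emptied and so are all full slots below it; the sum is constant in both cases. *)
  have /andP[_] : full b l p.+1 && ~~ full b l.+1 p.+1 by apply: fl; lia.
  rewrite fullS fillsE /full riggingS levelS nth_weights twosS !locES.
  have [[s1 s2] s3] := (twos_step b l p, twos_le b l p, twos_le b l.+1 p).
  by have := twos_step b l.+1 p; lia.
have {}IHn := IHn ltp (fun t ht => fl t ltac:(lia)).
have /andP[fn nfn] : full b l n && ~~ full b l.+1 n by apply: fl; lia.
have /andP[] : full b l n.+1 && ~~ full b l.+1 n.+1 by apply: fl; lia.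
rewrite levelS nth_weights twosS !locES in IHn *.
rewrite !fullS !fillsE; move: IHn fn nfn; rewrite /full.
have [[s1 s2] s3] := (twos_step b l n, twos_le b l n, twos_le b l.+1 n).
by have := twos_step b l.+1 n; lia.
Qed.

End Levels.

Lemma sum_nth0 (f : nat -> nat) (s : seq nat) n :
  f 0 = 0 -> size s <= n ->
  \sum_(k <- s) f k = \sum_(0 <= t < n) f (nth 0 s t).
Proof.
move=> f0 les; rewrite (big_nth 0) (@big_cat_nat _ _ _ (size s) 0 n) //=.
rewrite [X in _ = _ + X]big_nat_cond [X in _ = _ + X]big1 ?addn0 // => t.
by rewrite andbT => /andP[let_ _]; rewrite nth_default.
Qed.

(** Quantum spaces are compared through [nth 0], since a factor with no letter read yet has no entry
    in the list built by [incr_nth]. *)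
Lemma eq_sum_nth0 (f : nat -> nat) (s s' : seq nat) :
  f 0 = 0 -> nth 0 s =1 nth 0 s' -> \sum_(k <- s) f k = \sum_(k <- s') f k.
Proof.
move=> f0 eqs; rewrite (@sum_nth0 f s (maxn (size s) (size s'))) ?leq_maxl //.
rewrite (@sum_nth0 f s' (maxn (size s) (size s'))) ?leq_maxr //.
by apply: eq_bigr => t _; rewrite eqs.
Qed.

Lemma energyE b m : energy b m = \sum_(0 <= t < size b) locE b m t.+1.
Proof. by rewrite /energy big_add1. Qed.

Lemma vacancyE lam mu b m :
  nth 0 lam =1 nth 0 (weights b) -> \sum_(k <- mu) minn m k = energy b m ->
  vacancy lam mu m = level b m (size b).
Proof.
move=> eq_lam eq_mu; rewrite /vacancy eq_mu energyE /level.
rewrite (eq_sum_nth0 _ eq_lam) ?minn0 // (@sum_nth0 _ _ (size b)) ?minn0 //.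
by rewrite size_map.
Qed.

(** * Appending a factor to the path *)

Section Rcons.

Variables (b : seq (nat * nat)) (x : nat * nat).

Lemma twos_rcons l j : j <= size b -> twos (rcons b x) l j = twos b l j.
Proof.
elim: j => [|j IHj] // ltj; rewrite !twosS (IHj (ltnW ltj)).
by rewrite nth_rcons ltj.
Qed.

Lemma locE_rcons l j :
  j < size b -> locE (rcons b x) l j.+1 = locE b l j.+1.
Proof. by move=> ltj; rewrite !locES (twos_rcons _ (ltnW ltj)) nth_rcons ltj. Qed.

Lemma locE_rcons_last l :
  locE (rcons b x) l (size b).+1 = minn (l - twos b l (size b)) x.2.
Proof. by rewrite locES twos_rcons // nth_rcons ltnn eqxx. Qed.

Lemma fills_rcons l j :
  fills (rcons b x) l j =
  fills b l j || [&& j == size b, ~~ full b l j & l - twos b l j < x.2].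
Proof.
rewrite !fillsE /full; have [ltj | ltj | ->] := ltngtP j (size b).
- by rewrite !(twos_rcons _ (ltnW ltj)) nth_rcons ltj orbF.
- by rewrite !nth_default ?size_rcons ?ltn0 ?andbF // ltnW.
- by rewrite !twos_rcons // nth_rcons ltnn eqxx nth_default // andbF.
Qed.

Lemma energy_rcons m :
  energy (rcons b x) m = energy b m + minn (m - twos b m (size b)) x.2.
Proof.
rewrite !energyE size_rcons big_nat_recr //= locE_rcons_last; congr (_ + _).
by apply: eq_big_nat => t /andP[_ ltt]; rewrite locE_rcons.
Qed.

Lemma level_rcons m p : p <= size b -> level (rcons b x) m p = level b m p.
Proof.
move=> lep; rewrite /level.
congr (_%:Z - 2 * _%:Z)%R; apply: eq_big_nat => t /andP[_ ltt].
  by rewrite !nth_weights nth_rcons (leq_trans ltt lep).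
by rewrite locE_rcons ?(leq_trans ltt lep).
Qed.

End Rcons.

(** A string ending in the last column has filled every empty slot up to its own, so further letters
    2 leave its energy unchanged. *)
Lemma eq_end_row_rcons b x y lp :
  fills (rcons b x) lp.1 lp.2 -> x.2 <= y.2 ->
  end_row (rcons b x) lp = end_row (rcons b y) lp.
Proof.
case: lp => l p /= fp le2; have [_ ] := fills_bound fp.
rewrite size_rcons ltnS /end_row /= !riggingS => lep.
congr (_, (_ - _)%R); first by rewrite !level_rcons.
congr Posz; have [ltp | gep] := ltnP p (size b); first by rewrite !locE_rcons.
move: fp; have {gep lep} -> : p = size b by apply/eqP; rewrite eqn_leq lep.
rewrite !locE_rcons_last.
rewrite fills_rcons fillsE nth_default // ltn0 andbF eqxx /= /full.
by have := twos_step b l (size b); lia.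
Qed.

(** * Adding one letter *)


(** The invariant of the induction on letters; its last clause turns vacancy numbers into
    [level]. *)
Definition end_rows (b : seq (nat * nat)) (rows : seq (nat * int)) : Prop :=
  exists s, [/\ uniq s, forall lp, lp \in s <-> slot_end b lp,
    perm_eq rows [seq end_row b lp | lp <- s]
    & forall m, \sum_(lp <- s) minn m lp.1.+1 = energy b m].

Lemma eq_slot_end b b' lp :
  fills b =2 fills b' -> slot_end b lp -> slot_end b' lp.
Proof.
move=> eqf [fp hp]; split=> [|q leq]; rewrite -eqf // => fq.
by have [p [ltp fp']] := hp q leq fq; exists p; rewrite -eqf.
Qed.

Lemma end_rows_rcons0 b rows :
  end_rows b rows -> end_rows (rcons b (0, 0)) rows.
Proof.
have eqf l j : fills (rcons b (0, 0)) l j = fills b l j.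
  by rewrite fills_rcons /= ltn0 !andbF orbF.
case=> s [us mem_s rows_s sum_s]; exists s; split=> // [lp||m].
- by rewrite mem_s; split; apply: eq_slot_end => l j; rewrite eqf.
- apply: (perm_trans rows_s).
  rewrite (_ : [seq _ | lp <- s] = [seq end_row (rcons b (0, 0)) lp | lp <- s]) //.
  apply/eq_in_map => lp /mem_s[/fills_bound[_ ltp] _].
  by rewrite /end_row !riggingS level_rcons ?(ltnW ltp) // locE_rcons.
- by rewrite sum_s energy_rcons minn0 addn0.
Qed.

(** Letters 1 of the last factor only act on the carrier behind it, which enters no table entry and
    no rigging. *)
Lemma end_rows_rcons_ones b x y rows :
  x.2 = y.2 -> end_rows (rcons b x) rows -> end_rows (rcons b y) rows.
Proof.
move=> eq2; have eqf l j : fills (rcons b x) l j = fills (rcons b y) l j.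
  by rewrite !fills_rcons eq2.
case=> s [us mem_s rows_s sum_s]; exists s; split=> // [lp||m].
- by rewrite mem_s; split; apply: eq_slot_end => l j; rewrite eqf.
- apply: (perm_trans rows_s).
  rewrite (_ : [seq _ | lp <- s] = [seq end_row (rcons b y) lp | lp <- s]) //.
  by apply/eq_in_map => lp /mem_s[fp _]; apply: eq_end_row_rcons; rewrite ?eq2.
- by rewrite sum_s !energy_rcons eq2.
Qed.

Lemma twos_all_full b m j : (forall l, l < m -> full b l j) -> twos b m j = m.
Proof.
elim: m => [|m IHm] fl; first by have := twos_le b 0 j; lia.
have := IHm (fun l ltl => fl l (ltnW ltl)).
have := fl m (ltnSn m); rewrite /full; have := twos_step b m j; lia.
Qed.

Section AddTwo.

Variables (b : seq (nat * nat)) (k : nat).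
Let n := size b.
Let b1 := rcons b (0, k).
Let b2 := rcons b (0, k.+1).

(** This is the slot taken by the letter 2 that follows [k] others in the last factor. *)
Lemma next_slot : exists2 l, ~~ full b l n & l - twos b l n = k.
Proof.
have exm : exists m, k < m - twos b m n.
  (* The carrier holds at most as many letters 2 as [b], so more than [k] of these slots are
     empty. *)
  exists (k.+1 + \sum_(x <- b) x.2).
  have := twos_bound (k.+1 + \sum_(x <- b) x.2) (leqnn (size b)).
  by rewrite take_size -/n; lia.
have [[|l] ltk min_l] := ex_minnP exm; first by [].
have nltk : ~ k < l - twos b l n by move=> /min_l; lia.
exists l; rewrite /full; have := twos_step b l n; have := twos_le b l n; lia.
Qed.

Variable l0 : nat.
Hypotheses (nf0 : ~~ full b l0 n) (hole0 : l0 - twos b l0 n = k).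

Lemma holes_next m : (k < m - twos b m n) = (l0 < m).
Proof.
have s0 := twos_step b l0 n; have t0 := twos_le b l0 n.
move: nf0; rewrite /full => nf.
have [ltm | lem] := ltnP l0 m.
  by have := holes_homo b n ltm; lia.
by have := holes_homo b n lem; lia.
Qed.

Lemma fills_add l j :
  fills b2 l j <-> fills b1 l j \/ (l = l0 /\ j = n).
Proof.
rewrite !fills_rcons -/n /=; case: (fills b l j) => /=; first by split=> // _; left.
have [-> | nj] := eqVneq j n; last by split=> // -[|[]] // _ /eqP; rewrite (negbTE nj).
have [-> | nl] := eqVneq l l0; first by rewrite nf0 hole0 /=; split=> // _; right.
rewrite /=; split=> [/andP[nf ltk] | [/andP[nf ltk] | [eql _]]];
  last by rewrite eql eqxx in nl.
  left; rewrite nf /=; have := holes_next l; have := holes_next l.+1.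
  move: nf; rewrite /full; have := twos_step b l n; have := twos_le b l n; lia.
by rewrite nf leqW.
Qed.

Lemma fills_mem l j : fills b1 l j -> j <= n.
Proof. by case/fills_bound=> _; rewrite size_rcons. Qed.

Lemma no_fills_above l : l0 <= l -> ~~ fills b1 l n.
Proof.
move=> lel; rewrite fills_rcons -/n eqxx fillsE nth_default //= ltn0 andbF /=.
by have := holes_homo b n lel; rewrite hole0; lia.
Qed.

Lemma full_b1 l : full b1 l n.+1 = full b l n || fills b1 l n.
Proof.
rewrite fullS -/n orbC /full /b1 !twos_rcons // nth_rcons ltnn eqxx /=.
by rewrite leq0n andbT.
Qed.

(** Exactly [k] slots below [l0] were empty, and the [k] letters 2 fill them; there is no letter 1
    to empty any. *)
Lemma full_below l : l < l0 -> full b1 l n.+1.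
Proof.
move=> ltl; rewrite full_b1 fills_rcons -/n eqxx.
case fl : (full b l n) => //=; rewrite orbC.
have := holes_homo b n ltl; rewrite hole0 /=.
by move: fl; rewrite /full; have := twos_step b l n; have := twos_le b l n; lia.
Qed.

Lemma not_full_next : ~~ full b1 l0 n.+1.
Proof. by rewrite full_b1 (negbTE nf0) (negbTE (no_fills_above (leqnn _))). Qed.

Lemma twos_lt m : l0 < m -> twos b1 m n.+1 < m.
Proof.
move=> ltm; have := holes_homo b1 n.+1 ltm; have := not_full_next.
rewrite /full (twos_all_full full_below); have := twos_step b1 l0 n.+1.
by rewrite (twos_all_full full_below); lia.
Qed.

Lemma slot_end_next : slot_end b2 (l0, n).
Proof.
split=> /=; first by apply/fills_add; right.
move=> q leq /fills_add[fq | [] ]; last by lia.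
have eqq : q = n by apply/eqP; rewrite eqn_leq leq (fills_mem fq).
by rewrite eqq (negbTE (no_fills_above _)) in fq.
Qed.

Lemma slot_end_old lp : slot_end b2 lp -> lp <> (l0, n) -> slot_end b1 lp.
Proof.
case: lp => l p [/= /fills_add[fp | [-> ->] //] hp] _; split=> //= q leq fq.
have [|p' [ltp /fills_add[fp' | [el ep]]]] := hp q leq.
- by apply/fills_add; left.
- by exists p'.
have eqq : q = n by apply/eqP; rewrite eqn_leq (fills_mem fq) -ep; case/andP: ltp.
by rewrite eqq el (negbTE (no_fills_above _)) in fq.
Qed.

(** * The string lengthened by the new letter 2 *)

Section Lengthened.

Variables (l p : nat).
Hypotheses (l0E : l0 = l.+1) (ltp : p < n.+1) (fp : fills b1 l p)
  (fl : forall t, p < t <= n.+1 -> full b1 l t).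

Lemma fills_last q : fills b1 l q -> q <= p.
Proof.
move=> fq; rewrite leqNgt; apply/negP => ltq.
have : full b1 l q by apply: fl; rewrite ltq ltnW // ltnS (fills_mem fq).
by move: fq; rewrite fillsE => /andP[/negbTE->].
Qed.

Lemma no_fills_next q : p <= q -> ~~ fills b1 l0 q.
Proof.
move=> lepq; apply/negP => fq; have := not_full_next; rewrite l0E => nf.
have := full_fills fl nf (q := q); rewrite -l0E fq lepq ltnS (fills_mem fq).
by move=> /(_ isT).
Qed.

Lemma slot_end_lengthened : slot_end b1 (l, p).
Proof. by split=> //= q leq; rewrite -l0E (negbTE (no_fills_next leq)). Qed.

(** The new 1 at [(l0, n)] continues this string, slot [l] not being filled after [p]. *)
Lemma not_slot_end_lengthened : ~ slot_end b2 (l, p).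
Proof.
case=> /= _ /(_ n); rewrite -l0E; case=> //; first by apply/fills_add; right.
move=> q [/andP[ltq _] /fills_add[/fills_last | [el _]]]; first by lia.
by lia.
Qed.

(** The new 1 concerns only ends in slot [l]; these lie left of [p], and the 1 at [p] then comes
    before the new one. *)
Lemma slot_end_kept lp : slot_end b1 lp -> lp <> (l, p) -> slot_end b2 lp.
Proof.
case: lp => l' p' [/= fp' hp'] neq; split=> /=; first by apply/fills_add; left.
move=> q leq /fills_add[fq | [el eq]].
  have [//|p2 [lt2 f2]] := hp' q leq; exists p2; split=> //.
  by apply/fills_add; left.
have el' : l' = l by lia.
rewrite el' in fp' neq *; exists p; split; last by apply/fills_add; left.
have := fills_last fp'; rewrite leq_eqVlt => /orP[/eqP ep | ltp'].
  by rewrite ep in neq.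
by rewrite ltp' eq -ltnS.
Qed.

(** There is no slack, slot [l] having stayed full and slot [l.+1] empty since [p]; and [twos]
    equals [l.+1] because all slots below [l0] are full. *)
Lemma lengthened_singular :
  rigging (weights b1) b1 l.+1 p.+1 = level b1 l.+1 n.+1.
Proof.
have := @rigging_eq_level b1 l p n.+1 fp ltp; rewrite -l0E.
rewrite (twos_all_full full_below).
have nf t : p < t <= n.+1 -> ~~ full b1 l.+1 t.
  move=> ht; apply/negP => ft; have := not_full_next; rewrite l0E.
  by rewrite (full_stays fl ht ft).
move=> /(_ _)/GRing.addIr; apply=> t ht; rewrite l0E.
by rewrite fl //= nf.
Qed.

End Lengthened.

Lemma slot_end_kept0 lp : l0 = 0 -> slot_end b1 lp -> slot_end b2 lp.
Proof.
move=> l00; case: lp => l' p' [/= fp' hp']; split=> /=; first by apply/fills_add; left.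
move=> q leq /fills_add[fq | [el eq]]; last by lia.
have [//|p2 [lt2 f2]] := hp' q leq; exists p2; split=> //.
by apply/fills_add; left.
Qed.

Section Rows.

Variable rc : rigged.
Hypotheses (lamE : nth 0 rc.1 =1 nth 0 (weights b1)) (rowsE : end_rows b1 rc.2).

Lemma end_rows_vacancy m : vacancy rc.1 (lengths rc.2) m = level b1 m n.+1.
Proof.
have [s [_ _ rows_s sum_s]] := rowsE.
rewrite (vacancyE (b := b1) lamE) ?size_rcons // -sum_s big_map.
by rewrite (perm_big _ rows_s) big_map.
Qed.

(** A longer row would have the empty slot [l0] among its slots, so [rigging_le_level] would put its
    rigging strictly below the vacancy number. *)
Lemma singular_le row : row \in rc.2 -> singular rc row -> row.1 <= l0.
Proof.
have [s [_ mem_s rows_s _]] := rowsE.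
rewrite (perm_mem rows_s) => /mapP[[l p] /mem_s[/= fp _] ->].
rewrite /singular end_rows_vacancy /end_row /= => /eqP sing.
have := @rigging_le_level b1 l p n.+1 fp (fills_mem fp); rewrite sing leqNgt => le1.
apply/negP => /twos_lt; lia.
Qed.

Lemma longest_singularE : longest_singular rc = l0.
Proof.
apply/eqP; rewrite eqn_leq; apply/andP; split.
  by apply/bigmax_leqP_seq => row; apply: singular_le.
case l0E: l0 => [|l] //.
have [|p ltp [fp fl]] := @full_last_fill b1 l n.+1.
  by apply: full_below; rewrite l0E.
have [s [_ mem_s rows_s _]] := rowsE.
have := slot_end_lengthened l0E fp fl => /mem_s lps.
have rin : end_row b1 (l, p) \in rc.2.
  by rewrite (perm_mem rows_s); apply: map_f.
rewrite -[l.+1]/((end_row b1 (l, p)).1) /longest_singular.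
apply: (@leq_bigmax_seq _ _ (singular rc) (fun row => row.1) _ rin).
by rewrite /singular end_rows_vacancy /end_row /= (lengthened_singular l0E).
Qed.

(** The singular pair removed is the row of the lengthened string; among equal rows the copy removed
    does not matter, as rows are compared up to [perm_eq]. *)
Lemma rest_ends :
  exists s, [/\ uniq s,
    forall lp, lp \in s <-> slot_end b2 lp /\ lp <> (l0, n),
    perm_eq (rem (l0, level b1 l0 n.+1) rc.2) [seq end_row b1 lp | lp <- s]
    & forall m, \sum_(lp <- s) minn m lp.1.+1 + minn m l0 = energy b1 m].
Proof.
have [s [us mem_s rows_s sum_s]] := rowsE.
case l0E: l0 => [|l].
  exists s; split=> // [lp||m]; last by rewrite sum_s minn0 addn0.
    rewrite mem_s -l0E; split=> [e1|[e2 ne]]; last exact: slot_end_old.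
    split; first exact: slot_end_kept0.
    move=> eqlp; case: e1; rewrite eqlp /=.
    by rewrite (negbTE (no_fills_above (leqnn _))).
  (* Every row has positive length, so the pair of length 0 is absent and a new row will be
     created. *)
  rewrite rem_id //; apply/negP; rewrite (perm_mem rows_s).
  by case/mapP.
have [|p ltp [fp fl]] := @full_last_fill b1 l n.+1.
  by apply: full_below; rewrite l0E.
have e1 := slot_end_lengthened l0E fp fl; have lps := (mem_s _).2 e1.
have perm_s := perm_to_rem lps.
exists (rem (l, p) s); split; first exact: rem_uniq.
- move=> lp; rewrite mem_rem_uniq // inE -l0E; split.
    move=> /andP[/eqP ne /mem_s elp]; split.
      exact: (slot_end_kept l0E ltp fp fl elp ne).
    move=> eqlp; case: elp; rewrite eqlp /=.
    by rewrite (negbTE (no_fills_above (leqnn _))).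
  case=> elp ne; apply/andP; split; last by apply/mem_s/slot_end_old.
  by apply/eqP => eqlp; apply: (not_slot_end_lengthened l0E ltp fp fl); rewrite -eqlp.
- rewrite -(lengthened_singular l0E ltp fp fl).
  rewrite -[(_, _)]/(end_row b1 (l, p)).
  have rin : end_row b1 (l, p) \in rc.2 by rewrite (perm_mem rows_s); apply: map_f.
  rewrite -(perm_cons (end_row b1 (l, p))) -[X in perm_eq _ X]/(map _ (_ :: _)).
  rewrite -(permPl (perm_to_rem rin)) (permPl rows_s).
  exact: perm_map.
- by move=> m; rewrite -sum_s (perm_big _ perm_s) big_cons addnC.
Qed.

Lemma end_rows_add_two : end_rows b2 (add_two n.+1 rc).2.
Proof.
have [s [us mem_s rows_s sum_s]] := rest_ends.
have ends2 lp : lp \in (l0, n) :: s <-> slot_end b2 lp.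
  rewrite in_cons; split=> [/orP[/eqP-> | /mem_s[]//] | e2]; first exact: slot_end_next.
  by case: eqVneq => //= /eqP ne; apply/mem_s.
have sum2 m : \sum_(lp <- (l0, n) :: s) minn m lp.1.+1 = energy b2 m.
  rewrite big_cons /=; have := sum_s m; rewrite !energy_rcons -/n /=.
  by have := holes_next m; lia.
have row12 : [seq end_row b1 lp | lp <- s] = [seq end_row b2 lp | lp <- s].
  apply/eq_in_map => lp /mem_s[e2 ne].
  by have [fp _] := slot_end_old e2 ne; apply: eq_end_row_rcons.
exists ((l0, n) :: s); split=> //.
  rewrite /= us andbT; apply/negP => /mem_s[]; by [].
rewrite /add_two longest_singularE end_rows_vacancy /=.
set rest := rem _ _; have rest_s : perm_eq rest [seq end_row b2 lp | lp <- s].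
  by rewrite -row12.
suff -> : vacancy (incr_nth rc.1 n) (l0.+1 :: lengths rest) l0.+1 =
          rigging (weights b2) b2 l0.+1 n.+1 by rewrite perm_cons.
rewrite (vacancyE (b := b2)).
(* Both the energy and the width contribution of the last column equal [k.+1], so [level] drops by
   [k.+1], as the rigging requires. *)
- rewrite size_rcons levelS riggingS locE_rcons_last nth_weights nth_rcons ltnn eqxx /=.
  have := holes_next l0.+1; rewrite ltnSn -/n => ltk.
  have lek : k <= l0 by rewrite -hole0 leq_subr.
  by lia.
- move=> t; rewrite nth_incr_nth lamE !nth_weights !nth_rcons -/n.
  by rewrite eq_sym; case: ltngtP => //= _; rewrite ?addn0 // add0n add1n.
- rewrite -sum2 !big_cons /lengths big_map (perm_big _ rest_s) big_map.
  by [].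
Qed.

End Rows.
End AddTwo.

(** * The map phi *)


Lemma phi_rcons b x :
  phi (rcons b x) =
  iter x.1 (add_one (size b).+1) (iter x.2 (add_two (size b).+1) (phi b)).
Proof.
have iotaS : iota 1 (size b).+1 = iota 1 (size b) ++ [:: (size b).+1].
  by have := iotaD 1 (size b) 1; rewrite addn1 add1n.
rewrite /phi size_rcons iotaS foldl_cat /=.
rewrite {1}/add_factor {1 2}/item /= nth_rcons ltnn eqxx.
congr (iter _ _ (iter _ _ _)); move: ([::], [::]) => rc.
have : {in iota 1 (size b), forall i, 0 < i <= size b}.
  by move=> i; rewrite mem_iota.
elim: (iota _ _) rc => //= i s IHs rc les.
rewrite IHs => [|i' si']; last by apply: les; rewrite in_cons si' orbT.
have /andP[i0 lei] : 0 < i <= size b by apply: les; rewrite mem_head.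
by rewrite /add_factor /item nth_rcons prednK ?lei.
Qed.

Lemma iter_add_one i k rc :
  iter k (add_one i) rc = (iter k (incr_nth^~ i.-1) rc.1, rc.2).
Proof. by elim: k => [|k IHk]; [case: rc | rewrite iterS IHk]. Qed.

Lemma iter_add_two1 i k rc :
  (iter k (add_two i) rc).1 = iter k (incr_nth^~ i.-1) rc.1.
Proof. by elim: k => [|k IHk] //; rewrite iterS /= IHk. Qed.

Lemma nth_iter_incr i k v j :
  nth 0 (iter k (incr_nth^~ i) v) j = nth 0 v j + (i == j) * k.
Proof.
elim: k => [|k IHk]; first by rewrite muln0 addn0.
by rewrite iterS nth_incr_nth IHk; lia.
Qed.

(** The entry of a factor appears with its first letter, whence [0 < k]. *)
Lemma iter_incr_rcons v k :
  0 < k -> iter k (incr_nth^~ (size v)) v = rcons v k.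
Proof.
move=> k0; have sz : size (iter k (incr_nth^~ (size v)) v) = (size v).+1.
  case: k k0 => // k _; elim: k => [|k IHk]; first by rewrite size_incr_nth ltnn.
  by rewrite iterS size_incr_nth IHk leqnn.
apply: (@eq_from_nth _ 0); first by rewrite sz size_rcons.
move=> j _; rewrite nth_iter_incr nth_rcons.
case: ltngtP => [_|/ltnW lej|->]; rewrite ?mul0n ?mul1n ?addn0 //.
  by rewrite nth_default.
by rewrite nth_default.
Qed.

Lemma phi_quantum_space b :
  all (fun k => 0 < k) (weights b) -> (phi b).1 = weights b.
Proof.
elim/last_ind: b => [|b x IHb] //.
rewrite /weights map_rcons all_rcons => /andP[x0 /IHb eqb].
rewrite phi_rcons iter_add_one /= iter_add_two1 -iterD eqb /=.
by rewrite -{1}(size_map (fun x => x.1 + x.2) b) iter_incr_rcons.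
Qed.

Lemma nth_phi b : nth 0 (phi b).1 =1 nth 0 (weights b).
Proof.
elim/last_ind: b => [|b x IHb] j //.
rewrite phi_rcons iter_add_one /= iter_add_two1 -iterD nth_iter_incr IHb /=.
rewrite !nth_weights nth_rcons.
case: ltngtP => [_|/ltnW lej|->]; rewrite ?mul0n ?mul1n ?addn0 //=.
  by rewrite nth_default.
by rewrite nth_default //= ?add0n addnC.
Qed.

(** Induction on the factors, then on the letters 2 of the last one, taken as [(0, k)]; its letters
    1 are restored by [end_rows_rcons_ones]. *)
Lemma phi_end_rows b : end_rows b (phi b).2.
Proof.
elim/last_ind: b => [|b x IHb].
  exists [::]; split=> // [lp|m]; last by rewrite big_nil /energy big_geq.
  by rewrite in_nil; split=> // -[/fills_bound[]].
rewrite phi_rcons iter_add_one /=; apply: (@end_rows_rcons_ones b (0, x.2)) => //.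
elim: x.2 => [|k IHk]; first exact: end_rows_rcons0.
rewrite iterS; have [l nfl hole_l] := next_slot b k.
apply: (end_rows_add_two nfl hole_l) => // j.
rewrite iter_add_two1 nth_iter_incr nth_phi !nth_weights nth_rcons.
case: ltngtP => [_|/ltnW lej|->]; rewrite ?mul0n ?mul1n ?addn0 //=.
  by rewrite nth_default.
by rewrite nth_default //= ?add0n addnC.
Qed.

(** * From the picked positions to the rows of [phi] *)

Lemma row1_energy b :
  \sum_(1 <= j < (size b).+1) (local_energy_distribution b 1 j == 1%R) =
  energy b 1.
Proof.
rewrite energyE big_add1 /=; apply: eq_bigr => j _.
rewrite tableS /fills !locES sub0n min0n.
have := geq_minl (1 - twos b 1 j) (nth (0, 0) b j).2.
by case: minn => [|[|u]] //; lia.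
Qed.

Lemma path_weights lam b : is_path lam b -> lam = weights b.
Proof.
move=> [eqs wt]; apply: (@eq_from_nth _ 0); first by rewrite size_map.
move=> i lti; rewrite nth_weights; apply/esym/eqP.
exact: (wt i.+1).
Qed.

Local Open Scope ring_scope.

Theorem theorem3p3 (lam : seq nat) (b : seq (nat * nat))
    (lam_gt0 : forall i, (1 <= i <= size lam)%N -> (1 <= item 0%N lam i)%N)
    (b_path : is_path lam b) :
  let N := energy b 1 in
  let T := local_energy_distribution b in
  [/\ (* the entries of the table are 0 or 1 *)
      forall l j, (1 <= l)%N -> (1 <= j <= size lam)%N -> T l j = 0 \/ T l j = 1,
      (* Step 2 can be executed N times, whatever choices are made *)
      forall s T', (size s < N)%N -> rounds T s T' -> exists c, picking T' c
    & (* any N executions empty the table and yield phi b *)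
      forall s T', size s = N -> rounds T s T' ->
        [/\ forall l j, (1 <= l)%N -> (1 <= j <= size lam)%N -> T' l j = 0,
            (phi b).1 = lam
          & perm_eq (phi b).2 [seq (mj.1, rigging lam b mj.1 mj.2) | mj <- s]]].
Proof.
have T01 := table_zero_one b; have Til := @table_interlaced b.
move=> N T; split=> [l j _ _|s T' lts TT'|s T' eqs TT']; first exact: T01.1.
  (* Row 1 starts with [N] ones and loses one per round, so fewer than [N] rounds leave a 1 to start
     from. *)
  have [T'01 _ eqN _ _] := roundsP TT' T01 Til; rewrite row1_energy -/N in eqN.
  have [row1 | none] := boolP (has (fun j => T' 1%N j == 1) (index_iota 1 (size b).+1)).
    by have [j _ /eqP Tj] := hasP row1; apply: picking_exists T'01 Tj.
  rewrite big_seq big1 ?addn0 in eqN => [|j jn]; first by rewrite eqN ltnn in lts.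
  by rewrite (negbTE (hasPn none j jn)).
have [T'01 T'il eqN us [ends _]] := roundsP TT' T01 Til.
(* After [N] rounds row 1 is exhausted, and interlacing then empties every other row. *)
have T'1 p : T' 1%N p <> 1.
  move=> Tp; have [_ pn] := T'01.2 _ _ Tp.
  rewrite row1_energy -/N eqs (bigD1_seq p) ?iota_uniq ?mem_index_iota //= Tp eqxx in eqN.
  by move: eqN; lia.
have T'0 l j : (1 <= l)%N -> T' l j = 0.
  by move=> l1; have [//|/(interlaced_row1 T'il T'1 l1)] := T'01.1 l j.
have lamE := path_weights b_path.
split=> [l j l1 _||]; first exact: T'0.
  rewrite lamE; apply: phi_quantum_space; rewrite -lamE.
  by apply/(all_nthP 0%N) => i lti; apply: (lam_gt0 i.+1).
have no_end lp : ~ string_end T' lp.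
  case=> Tlp _; have [/andP[l1 _] _] := T'01.2 _ _ Tlp.
  exact: interlaced_row1 T'il T'1 l1 Tlp.
have [s0 [us0 mem_s0 rows_s0 _]] := phi_end_rows b.
(* Both lists enumerate the string ends without repetition, in slot and in table coordinates;
   positivity of the latter makes the shift injective. *)
have s_s0 : perm_eq s0 [seq (lp.1.-1, lp.2.-1) | lp <- s].
  have pos lp : lp \in s -> (0 < lp.1)%N /\ (0 < lp.2)%N.
    by move=> ls; have [/table_oneP] := (ends lp).2 (or_introl ls).
  apply: uniq_perm => // [|[l p]].
    rewrite map_inj_in_uniq // => -[l p] [l' p'] /pos[/= l0 p0] /pos[/= l0' p0'] [el ep].
    by congr (_, _); lia.
  apply/idP/mapP => [/mem_s0/string_endE/ends[ls | /no_end//] | [[l' p'] ls [-> ->]]].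
    by exists (l.+1, p.+1).
  have [/= l0 p0] := pos _ ls.
  by apply/mem_s0/string_endE; rewrite !prednK //; apply/ends; left.
apply: (perm_trans rows_s0); apply: (perm_trans (perm_map _ s_s0)).
rewrite -map_comp.
rewrite (_ : [seq _ | i <- s] = [seq (mj.1, rigging lam b mj.1 mj.2) | mj <- s]) //.
apply/eq_in_map => -[l p] ls; rewrite /end_row lamE /=.
have [/table_oneP[/= l0 p0] _] := (ends (l, p)).2 (or_introl ls).
by rewrite !prednK.
Qed.
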